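(* There is an absolute constant $C$ such that for every horizon $T\ge 2$ there exists a randomized forecasting algorithm (making predictions in a finite subset of $(0,1)$) which, against every adversary, guarantees $\mathbb{E}[\mathsf{SReg}^{\ell}]\le C\,T^{1/3}(\log T)^{5/3}$ for the log loss $\ell$, where the expectation is over the algorithm's internal randomness. Equivalently, $\mathbb{E}[\mathsf{KLCal}]\le C\,T^{1/3}(\log T)^{5/3}$.
   Context: Forecasting protocol: for $t=1,\dots,T$, the forecaster (randomly) predicts $p_t\in[0,1]$ and simultaneously the adversary chooses $y_t\in\{0,1\}$, which is then revealed; the adversary is oblivious, i.e. it fixes $y_1,\dots,y_T$ in advance with knowledge of the forecaster's algorithm. Log loss: $\ell(p,y)=-y\log p-(1-y)\log(1-p)$. Swap regret: $\mathsf{SReg}^\ell:=\sup_{\sigma:[0,1]\to[0,1]}\sum_{t=1}^T(\ell(p_t,y_t)-\ell(\sigma(p_t),y_t))$. With $\rho_p=\frac{\sum_t y_t\mathbb{1}\{p_t=p\}}{\sum_t\mathbb{1}\{p_t=p\}}$ ($0/0=0$) and Bernoulli KL $\mathsf{KL}(q,p)=q\log\frac qp+(1-q)\log\frac{1-q}{1-p}$, $\mathsf{KLCal}:=\sum_{p}\sum_t\mathbb{1}\{p_t=p\}\mathsf{KL}(\rho_p,p)$, the outer sum over the (finitely many) values predicted; for the log loss $\mathsf{SReg}^\ell=\mathsf{KLCal}$. *)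

(* Defs.v *)
From HB Require Import structures.
From mathcomp Require Import all_boot all_order all_algebra.
From mathcomp Require Import all_classical all_reals all_analysis.
Set Implicit Arguments. Unset Strict Implicit. Unset Printing Implicit Defensive.
Import Order.TTheory GRing.Theory Num.Theory.
Local Open Scope ring_scope.

Section Forecasting.
Variable R : realType.

(** Bernoulli KL divergence KL(q,p); the convention 0 log 0 = 0 holds
    automatically since the factor q (resp. 1-q) vanishes. *)
Definition KLb (q p : R) : R :=
  q * ln (q / p) + (1 - q) * ln ((1 - q) / (1 - p)).

Definition nrounds (T : nat) (p : 'I_T -> R) (v : R) : R :=
  \sum_(t < T | p t == v) 1.

Definition rho (T : nat) (p : 'I_T -> R) (y : 'I_T -> bool) (v : R) : R :=
  (\sum_(t < T | p t == v) (y t)%:R) / nrounds p v.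

Definition KLCal (T : nat) (p : 'I_T -> R) (y : 'I_T -> bool) : R :=
  \sum_(v <- undup [seq p t | t : 'I_T]) nrounds p v * KLb (rho p y v) v.

(** -log x, with -log 0 = +oo (only used for x in [0,1]). *)
Definition neglog (x : R) : \bar R := if x <= 0 then +oo%E else (- ln x)%:E.

Definition logloss (p : R) (y : bool) : \bar R :=
  if y then neglog p else neglog (1 - p).

Definition SReg (T : nat) (p : 'I_T -> R) (y : 'I_T -> bool) : \bar R :=
  ereal_sup [set (\sum_(t < T) (logloss (p t) (y t) - logloss (sigma (p t)) (y t)))%E
            | sigma in [set s : R -> R | forall x, 0 <= x <= 1 -> 0 <= s x <= 1]].

(** A randomized forecaster predicting in the finite set {fval i | i : 'I_fk}
    of (0,1).  At round t (= size of the histories), given the past outcomes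
    ys = y_1..y_{t-1} and its own past (indices of) predictions ps, it draws
    the index of its next prediction according to fprob ys ps. *)
Record forecaster := Forecaster {
  fk : nat;
  fval : 'I_fk -> R;
  fval_in : forall i, 0 < fval i < 1;
  fprob : seq bool -> seq 'I_fk -> 'I_fk -> R;
  fprob_ge0 : forall ys ps i, 0 <= fprob ys ps i;
  fprob_sum1 : forall ys ps, \sum_i fprob ys ps i = 1 }.

(** Probability that the forecaster's index sequence is q against the
    (oblivious, fixed in advance) outcome sequence y. *)
Definition path_prob (A : forecaster) (T : nat) (y : 'I_T -> bool)
    (q : {ffun 'I_T -> 'I_(fk A)}) : R :=
  \prod_(t < T) @fprob A [seq y s | s <- take t (enum 'I_T)]
                        [seq q s | s <- take t (enum 'I_T)] (q t).

Definition exp_SReg (A : forecaster) (T : nat) (y : 'I_T -> bool) : \bar R :=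
  (\sum_(q : {ffun 'I_T -> 'I_(fk A)})
      (@path_prob A T y q)%:E * SReg (fun t => fval (q t)) y)%E.

Definition exp_KLCal (A : forecaster) (T : nat) (y : 'I_T -> bool) : R :=
  \sum_(q : {ffun 'I_T -> 'I_(fk A)})
      @path_prob A T y q * KLCal (fun t => fval (q t)) y.

End Forecasting.

(* Main.v *)
Require Import Defs.
From HB Require Import structures.
From mathcomp Require Import all_boot all_order all_algebra.
From mathcomp Require Import all_classical all_reals all_analysis.
From mathcomp Require Import ring lra zify.
Import Order.TTheory GRing.Theory Num.Theory.
Local Open Scope ring_scope.

(** Write [l] for the log loss.  In each bin (grid value [v i]) compare the
    forecaster with the Laplace estimator [L i] of that bin.  The Laplace
    estimator assigns to the [n] outcomes seen in a bin a probability at least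
    [1 / (n + 1)] times that of any constant prediction, so the swap regret is at
    most [\sum_t (l(p_t, y_t) - l(L_t, y_t))] plus [ln (T + 1)] per bin.

    Each summand has small conditional expectation under a suitable law, whatever
    [y_t] is: take two adjacent bins between which [L i - v i] changes sign and mix
    them so that the loss difference is the same for [y_t = 0] and [y_t = 1].  The
    common value is the mean of the loss difference under [y ~ Bernoulli (v i)],
    which is at most the chi-square divergence of [v i] from [v i.+1].  On the grid
    [x^2 / (x^2 + y^2)], [x + y = N + 2], this is O(1 / N^2), so the total is
    [O(N ln T + T / N^2)] and [N = T^(1/3)] is enough. *)

Set Implicit Arguments.
Unset Strict Implicit.
Unset Printing Implicit Defensive.

(** * One round: a prediction law that is good against both outcomes *)

Section OneRound.
Context {R : realType}.
Implicit Types (p q r x : R) (b : bool).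

Definition lik p b : R := if b then p else 1 - p.

Lemma lik_gt0 p b : 0 < p < 1 -> 0 < lik p b.
Proof. by move=> /andP[p0 p1]; case: b => //=; rewrite subr_gt0. Qed.

Lemma ln_le_sub1 x : 0 < x -> ln x <= x - 1.
Proof. by move=> x0; rewrite -[in ln x](subrKC 1 x); apply: le_ln1Dx; lra. Qed.

Lemma lnB_le x y : 0 < x -> 0 < y -> ln x - ln y <= x / y - 1.
Proof.
move=> x0 y0; rewrite -ln_div ?posrE//; apply: ln_le_sub1; exact: divr_gt0.
Qed.

(* Gibbs' inequality for [p] against [r], plus the bound of the divergence of
   [p] from [q] by the chi-square divergence. *)
Lemma expected_loss_le_chi2 p q r : 0 < p < 1 -> 0 < q < 1 -> 0 < r < 1 ->
  p * (ln r - ln q) + (1 - p) * (ln (1 - r) - ln (1 - q)) <=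
  (p - q) ^+ 2 / (q * (1 - q)).
Proof.
move=> /andP[p0 p1] /andP[q0 q1] /andP[r0 r1].
have := lnB_le r0 p0.
have := lnB_le p0 q0.
have [p1' q1' r1'] : [/\ 0 < 1 - p, 0 < 1 - q & 0 < 1 - r] by split; lra.
have := lnB_le r1' p1'.
have := lnB_le p1' q1'.
move=> h1 h2 h3 h4.
have -> : (p - q) ^+ 2 / (q * (1 - q)) = p * ((r / p - 1) + (p / q - 1)) +
   (1 - p) * (((1 - r) / (1 - p) - 1) + ((1 - p) / (1 - q) - 1)).
  by field; rewrite !gt_eqF.
by apply: lerD; rewrite ler_pM2l//; lra.
Qed.

(* [t] is the mixture making both coordinates equal; their common value is then
   also the average with weights [p] and [1 - p]. *)
Lemma equalizing_mixture (u0 u1 w0 w1 p e : R) : 0 <= p <= 1 ->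
  u0 <= u1 -> w1 <= w0 -> 0 <= e ->
  p * u1 + (1 - p) * u0 <= e -> p * w1 + (1 - p) * w0 <= e ->
  exists2 t, 0 <= t <= 1 &
    t * u1 + (1 - t) * w1 <= e /\ t * u0 + (1 - t) * w0 <= e.
Proof.
move=> /andP[p0 p1] u01 w10 e0 hu hw.
set s := (u1 - u0) + (w0 - w1).
(* If [s = 0], both nonnegative gaps vanish and [t = 1] already equalizes. *)
have [s0|s0] := eqVneq s 0.
  exists 1; first by rewrite ler01 lexx.
  have E1 : u1 = u0 by rewrite /s in s0; lra.
  by move: hu; rewrite E1; split; lra.
have sp : 0 < s by rewrite lt_def s0 /s; lra.
exists ((w0 - w1) / s).
  by rewrite divr_ge0 ?subr_ge0 ?(ltW sp)//= ler_pdivrMr// mul1r /s; lra.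
set t := (w0 - w1) / s.
have t01 : 0 <= t <= 1.
  by rewrite divr_ge0 ?subr_ge0 ?(ltW sp)//= ler_pdivrMr// mul1r /s; lra.
have eqm : t * u1 + (1 - t) * w1 = t * u0 + (1 - t) * w0.
  by rewrite /t /s; field.
have : t * (p * u1 + (1 - p) * u0) + (1 - t) * (p * w1 + (1 - p) * w0) <= e.
  case/andP: t01 => t0 t1.
  have -> : e = t * e + (1 - t) * e by ring.
  by apply: lerD; apply: ler_wpM2l; rewrite ?subr_ge0.
have -> : t * (p * u1 + (1 - p) * u0) + (1 - t) * (p * w1 + (1 - p) * w0) =
  p * (t * u1 + (1 - t) * w1) + (1 - p) * (t * u0 + (1 - t) * w0) by ring.
by rewrite -eqm => h; split; lra.
Qed.

Lemma first_crossing (P : pred nat) n : P 0%N -> ~~ P n ->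
  exists2 i, (i < n)%N & P i && ~~ P i.+1.
Proof.
move=> P0; elim: n => [|n IH] nP; first by rewrite P0 in nP.
case Pn: (P n); first by exists n => //; rewrite Pn.
by have [|i lin Pi] := IH; [rewrite Pn|exists i => //; apply: ltnW].
Qed.

Lemma sum_pointmass n (j : 'I_n) (f : 'I_n -> R) :
  \sum_i (i == j)%:R * f i = f j.
Proof.
rewrite (bigD1 j)//= eqxx mul1r big1 ?addr0// => i /negbTE ->.
by rewrite mul0r.
Qed.

(* The bounds on [- ln (1 - v 0)] and [- ln (v n)] deal with the case where
   [L i - v i] has no sign change: an extreme bin is played. *)
Lemma exists_prediction_law n (v : nat -> R) (L : 'I_n.+1 -> R) (e : R) :
  (forall i, (i <= n)%N -> 0 < v i < 1) -> (forall i, 0 < L i < 1) ->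
  0 <= e -> - ln (1 - v 0%N) <= e -> - ln (v n) <= e ->
  (forall i, (i < n)%N ->
     (v i - v i.+1) ^+ 2 / (v i.+1 * (1 - v i.+1)) <= e) ->
  exists P : 'I_n.+1 -> R, [/\ forall i, 0 <= P i, \sum_i P i = 1 &
    forall b, \sum_i P i * (ln (lik (L i) b) - ln (lik (v i) b)) <= e].
Proof.
move=> v01 L01 e0 hfst hlst hstep.
pose g i b := ln (lik (L i) b) - ln (lik (v i) b).
have v01l (i : 'I_n.+1) := lik_gt0 _ (v01 i (ltn_ord i)); have L01l i := lik_gt0 _ (L01 i).
have lnL_le0 i b : ln (lik (L i) b) <= 0.
  by apply: ln_le0; have := L01 i; case: b => /=; lra.
have pm j : (forall b, g j b <= e) -> exists P : 'I_n.+1 -> R,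
   [/\ forall i, 0 <= P i, \sum_i P i = 1 & forall b, \sum_i P i * g i b <= e].
  move=> gj; exists (fun i => (i == j)%:R); split=> [i||b].
  - exact: ler0n.
  - by under eq_bigr do rewrite -[_%:R]mulr1; rewrite (sum_pointmass j (fun=> 1)).
  - by rewrite (sum_pointmass j (g^~ b)).
have mono i b : lik (L i) b <= lik (v i) b -> g i b <= 0.
  by move=> h; rewrite /g subr_le0 ler_ln ?posrE.
have mono' (i : 'I_n.+1) b : lik (v i) b <= lik (L i) b -> 0 <= g i b.
  by move=> h; rewrite /g subr_ge0 ler_ln ?posrE.
pose Q (i : nat) := v i <= L (inord i).
have ord i : (i <= n)%N -> (inord i : 'I_n.+1) = i :> nat.
  by move=> ?; rewrite inordK.
have [Q0|Q0] := boolP (Q 0%N); last first.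
  rewrite /Q -ltNge in Q0; apply: (pm (inord 0)) => -[].
    by apply: le_trans e0; apply: mono; rewrite /= ord// ltW.
  rewrite /g/= ord//; have := lnL_le0 (inord 0) false => /=.
  by move: hfst; lra.
have [Qn|Qn] := boolP (Q n).
  apply: (pm (inord n)) => -[].
    rewrite /g/= ord//; have := lnL_le0 (inord n) true => /=.
    by move: hlst; lra.
  by apply: le_trans e0; apply: mono; rewrite /= ord//; move: Qn; rewrite /Q; lra.
have [i ltin /andP[Qi Qi1]] := first_crossing Q0 Qn.
rewrite /Q -ltNge in Qi1; rewrite /Q in Qi.
pose j : 'I_n.+1 := inord i; pose k : 'I_n.+1 := inord i.+1.
have [vi vi1] := (v01 i (ltnW ltin), v01 i.+1 ltin).
have ji : j = i :> nat by rewrite ord// ltnW.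
have ki : k = i.+1 :> nat by rewrite ord.
(* At [j] the loss difference is larger for outcome 1, at [k] for outcome 0. Averaged with weight
   [v i], it is at most 0 at [j] by Gibbs' inequality, and at most the chi-square divergence of
   [v i] from [v i.+1] at [k]. *)
have := @equalizing_mixture (g j false) (g j true) (g k false) (g k true) (v i) e.
case=> //.
- by move: vi; lra.
- by apply: (@le_trans _ _ 0); [apply: mono|apply: mono']; rewrite /= ji; move: Qi; rewrite -/j; lra.
- by apply: (@le_trans _ _ 0); [apply: mono|apply: mono']; rewrite /= ki; move: Qi1; rewrite -/k; lra.
- have := expected_loss_le_chi2 vi vi (L01 j).
  by rewrite subrr expr0n mul0r /g/= ji; lra.
- have := expected_loss_le_chi2 vi vi1 (L01 k).
  by have := hstep i ltin; rewrite /g/= ki; lra.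
move=> t t01 [ht hf].
have sumP (f : 'I_n.+1 -> R) :
    \sum_m (t * (m == j)%:R + (1 - t) * (m == k)%:R) * f m = t * f j + (1 - t) * f k.
  under eq_bigr do rewrite mulrDl -!mulrA.
  by rewrite big_split/= -!mulr_sumr !sum_pointmass.
exists (fun m => t * (m == j)%:R + (1 - t) * (m == k)%:R); split=> [m||].
- by apply: addr_ge0; apply: mulr_ge0; rewrite ?ler0n//; lra.
- by have := sumP (fun=> 1); under eq_bigr do rewrite mulr1; move=> ->; ring.
- by move=> b; rewrite (sumP (g^~ b)); case: b.
Qed.

(** * A grid refined quadratically towards 0 and 1 *)

Definition grid (N i : nat) : R :=
  i.+1%:R ^+ 2 / (i.+1%:R ^+ 2 + (N.+1 - i)%:R ^+ 2).

Lemma onem_grid N i :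
  1 - grid N i = (N.+1 - i)%:R ^+ 2 / (i.+1%:R ^+ 2 + (N.+1 - i)%:R ^+ 2).
Proof.
by rewrite /grid; field; apply: lt0r_neq0; apply: ltr_pwDl; rewrite ?exprn_gt0 ?ltr0n ?sqr_ge0.
Qed.

Lemma grid_itv N i : (i <= N)%N -> 0 < grid N i < 1.
Proof.
move=> iN; have x0 : (0 : R) < i.+1%:R ^+ 2 by rewrite exprn_gt0 ?ltr0n.
have y0 : (0 : R) < (N.+1 - i)%:R ^+ 2 by rewrite exprn_gt0 ?ltr0n ?subn_gt0.
apply/andP; split; first by rewrite divr_gt0 ?addr_gt0.
by rewrite -subr_gt0 onem_grid divr_gt0 ?addr_gt0.
Qed.

(** This is [ln (1 + 1 / x) <= 1 / x]; at both ends of the grid it is used with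
    [x = (N + 1) ^ 2]. *)
Lemma neg_ln_ratio_le x : 0 < x -> - ln (x / (1 + x)) <= x^-1.
Proof.
move=> x0; have x1 : 0 < 1 + x by lra.
rewrite -lnV ?posrE ?divr_gt0// invf_div.
apply: le_trans (ln_le_sub1 _) _; first exact: divr_gt0.
by rewrite mulrDl mul1r divff ?gt_eqF// addrK.
Qed.

Lemma grid_first N : - ln (1 - grid N 0) <= (N.+1%:R ^+ 2)^-1.
Proof.
by rewrite onem_grid subn0 expr1n; apply: neg_ln_ratio_le; rewrite exprn_gt0 ?ltr0n.
Qed.

Lemma grid_last N : - ln (grid N N) <= (N.+1%:R ^+ 2)^-1.
Proof.
by rewrite /grid subSnn expr1n addrC; apply: neg_ln_ratio_le; rewrite exprn_gt0 ?ltr0n.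
Qed.

(** Steps of the grid scale like [sqrt (p * (1 - p)) / N], which makes the chi-square divergence of
    neighbours [O(1 / N^2)] uniformly in [i]. *)
Lemma grid_step N i : (i < N)%N ->
  (grid N i - grid N i.+1) ^+ 2 / (grid N i.+1 * (1 - grid N i.+1)) <=
  36 / N.+1%:R ^+ 2.
Proof.
move=> iN; rewrite onem_grid /grid.
set x : R := i.+1%:R; set y : R := (N.+1 - i)%:R.
have -> : i.+2%:R = x + 1 :> R by rewrite -natr1.
have -> : (N.+1 - i.+1)%:R = y - 1 :> R.
  by rewrite subSS /y subSn ?(ltnW iN)// -natr1 addrK.
have -> : N.+1%:R = x + y - 1 :> R.
  by rewrite /x /y -natrD; apply/eqP; rewrite -subr_eq opprK natr1; apply/eqP; congr _%:R; lia.
have x1 : 1 <= x by rewrite ler1n.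
have y2 : 2 <= y by rewrite ler_nat; lia.
move: x y x1 y2 => {iN} x y x1 y2.
have D0 : 0 < x ^+ 2 + y ^+ 2 by nra.
have D0' : 0 < (x + 1) ^+ 2 + (y - 1) ^+ 2 by nra.
(* The numerator of the difference is [(x * (y - 1)) ^ 2 - ((x + 1) * y) ^ 2], which factors with
   [x * (y - 1) - (x + 1) * y = - (x + y)]. *)
have -> : (x ^+ 2 / (x ^+ 2 + y ^+ 2) - (x + 1) ^+ 2 / ((x + 1) ^+ 2 + (y - 1) ^+ 2)) ^+ 2 /
  ((x + 1) ^+ 2 / ((x + 1) ^+ 2 + (y - 1) ^+ 2) *
   ((y - 1) ^+ 2 / ((x + 1) ^+ 2 + (y - 1) ^+ 2))) =
  ((x + y) * ((x * (y - 1) + (x + 1) * y) / ((x + 1) * (y - 1))) / (x ^+ 2 + y ^+ 2)) ^+ 2.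
  by field; rewrite !gt_eqF//=; lra.
(* The ratio is [x / (x + 1) + y / (y - 1)], at most [1 + 2] since [y >= 2]. *)
have r3 : 0 <= (x * (y - 1) + (x + 1) * y) / ((x + 1) * (y - 1)) <= 3.
  rewrite divr_ge0 ?ler_pdivrMr/=; nra.
set r := _ / ((x + 1) * (y - 1)) in r3 *.
have -> : 36 / (x + y - 1) ^+ 2 = (6 / (x + y - 1)) ^+ 2 by rewrite expr_div_n; congr (_ / _); ring.
case/andP: r3 => r0 r3.
rewrite ler_pXn2r// ?nnegrE; last 2 first.
- by apply: divr_ge0; [apply: mulr_ge0; lra|lra].
- by apply: divr_ge0; lra.
rewrite ler_pdivrMr// mulrAC ler_pdivlMr; last lra.
apply: (@le_trans _ _ ((x + y) * 3 * (x + y - 1))).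
  by apply: ler_wpM2r; [lra|apply: ler_wpM2l; lra].
(* Uses [(x + y) ^ 2 <= 2 * (x ^ 2 + y ^ 2)]. *)
have := sqr_ge0 (x - y); nra.
Qed.

End OneRound.

(** * Laplace estimators in the bins against constant predictions *)

Section Bins.
Context {R : realType} {I : finType}.
Implicit Types (h : seq (I * bool)) (i : I) (s : I -> R).

Definition laplace h i : R :=
  (count_mem (i, true) h).+1%:R /
  (count_mem (i, true) h + count_mem (i, false) h).+2%:R.

(* Beta integral: the probability that a Laplace forecaster assigns to a given
   sequence of [a] ones and [b] zeros. *)
Definition binlap (a b : nat) : R := (a`! * b`!)%:R / (a + b).+1`!%:R.

(** Each bin runs its own Laplace estimator, so the history's probability is a product over bins and
    depends only on counts. *)
Definition lapprob h : R :=
  \prod_i binlap (count_mem (i, true) h) (count_mem (i, false) h).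

Definition likelihood s h : R := \prod_(x <- h) lik (s x.1) x.2.

Lemma laplace_itv h i : 0 < laplace h i < 1.
Proof.
rewrite divr_gt0 ?ltr0n//= /laplace ltr_pdivrMr ?ltr0n// mul1r ltr_nat; lia.
Qed.

Lemma binlap_gt0 a b : 0 < binlap a b.
Proof. by rewrite divr_gt0// ltr0n ?muln_gt0 ?fact_gt0. Qed.

Lemma lapprob_gt0 h : 0 < lapprob h.
Proof. by apply: prodr_gt0 => i _; exact: binlap_gt0. Qed.

Lemma lapprob_nil : lapprob [::] = 1.
Proof. by rewrite /lapprob big1// => i _; rewrite /binlap !fact0 divff. Qed.

(** Only the factor of bin [i] changes, and [binlap a.+1 b / binlap a b = (a + 1) / (a + b + 2)] is
    the Laplace estimate. Hence [- ln (lapprob h)] accumulates the log losses of the Laplace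
    predictions. *)
Lemma lapprob_rcons h i b : lapprob (rcons h (i, b)) = lapprob h * lik (laplace h i) b.
Proof.
have fS n : n.+1`!%:R = n.+1%:R * n`!%:R :> R by rewrite factS natrM.
have f0 n : n`!%:R != 0 :> R by rewrite pnatr_eq0 -lt0n fact_gt0.
rewrite /lapprob (bigD1 i)//= [in RHS](bigD1 i)//= [RHS]mulrAC; congr (_ * _).
  rewrite -!cats1 !count_cat /= /laplace /binlap.
  set m := count_mem _ h; set n := count_mem _ h.
  case: b; rewrite /= !xpair_eqE eqxx/= !(addn0, addn1) ?addSn ?addnS ![(_`! * _`!)%:R]natrM !fS;
    field; rewrite f0 -!natrD nat1r !pnatr_eq0//.
apply: eq_bigr => j /negbTE ji.
by rewrite -!cats1 !count_cat /= !xpair_eqE ![i == j]eq_sym ji /= !addn0.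
Qed.

Lemma likelihoodE s h : likelihood s h =
  \prod_i (s i ^+ count_mem (i, true) h * (1 - s i) ^+ count_mem (i, false) h).
Proof.
elim: h => [|[i b] h IH]; first by rewrite /likelihood big_nil big1// => i _; rewrite !expr0 mulr1.
rewrite /likelihood big_cons -/(likelihood s h) IH/= (bigD1 i)//= [in RHS](bigD1 i)//= mulrA.
congr (_ * _).
  by case: b; rewrite /= !xpair_eqE eqxx/= ?add0n ?add1n ?exprS; ring.
apply: eq_bigr => j /negbTE ji.
by rewrite !xpair_eqE ![i == j]eq_sym ji /= !add0n.
Qed.

(** The left side times ['C(a + b, a)] is one term of the binomial expansion of
    [1 = ((1 - p) + p) ^ (a + b)], and the right side is the inverse of that coefficient. *)
Lemma bernoulli_le_binlap (p : R) a b : 0 <= p <= 1 ->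
  p ^+ a * (1 - p) ^+ b <= (a + b).+1%:R * binlap a b.
Proof.
move=> /andP[p0 p1]; have q0 : 0 <= 1 - p by lra.
have : p ^+ a * (1 - p) ^+ b *+ 'C(a + b, a) <= 1.
  have {2}<- : ((1 - p) + p) ^+ (a + b) = 1 by rewrite subrK expr1n.
  rewrite [leRHS]exprDn [leRHS](bigD1 (inord a))//= inordK ?ltnS ?leq_addr//.
  rewrite (addKn a b) [_ ^+ b * _]mulrC lerDl sumr_ge0// => i _.
  by rewrite mulrn_wge0// mulr_ge0 ?exprn_ge0.
have f0 n : n`!%:R != 0 :> R by rewrite pnatr_eq0 -lt0n fact_gt0.
have -> : (a + b).+1%:R * binlap a b = ('C(a + b, a)%:R)^-1.
  have := bin_fact (leq_addr b a); rewrite addKn => /(congr1 (fun n => n%:R : R)).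
  rewrite /binlap factS !natrM => <-.
  by field; rewrite !f0 -natrD nat1r !pnatr_eq0 -!lt0n bin_gt0 leq_addr.
have C0 : (0 : R) < 'C(a + b, a)%:R by rewrite ltr0n bin_gt0 leq_addr.
by rewrite -mulr_natr -ler_pdivlMr// div1r.
Qed.

Lemma likelihood_le s h : (forall i, 0 <= s i <= 1) ->
  likelihood s h <= (size h).+1%:R ^+ #|I| * lapprob h.
Proof.
move=> s01; rewrite likelihoodE /lapprob -prodr_const -big_split/=.
apply: ler_prod => i _; apply/andP; split.
  by have /andP[? ?] := s01 i; rewrite mulr_ge0 ?exprn_ge0//; lra.
apply: le_trans (bernoulli_le_binlap _ _ (s01 i)) _.
apply: ler_wpM2r; first exact/ltW/binlap_gt0.
(* The two counted events are disjoint, so the counts add up to that of a union, at most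
   [size h]. *)
rewrite ler_nat ltnS -count_predUI.
rewrite [X in (_ + X)%N](@eq_count _ _ pred0); last first.
  by move=> x /=; apply/negP => /andP[/eqP -> /eqP].
by rewrite count_pred0 addn0 count_size.
Qed.

End Bins.

(** * Expectations along random prediction paths *)

Section Expectation.
Context {R : realType}.

Lemma sum_tupleS (I : finType) n (F : n.+1.-tuple I -> R) :
  \sum_(w : n.+1.-tuple I) F w = \sum_i \sum_(w : n.-tuple I) F (cons_tuple i w).
Proof.
rewrite pair_bigA/= (reindex (fun x : I * n.-tuple I => cons_tuple x.1 x.2))//=.
exists (fun w => (thead w, behead_tuple w)) => [[i w]|w] _ /=.
  by congr (_, _); apply: val_inj.
by rewrite [RHS]tuple_eta; apply: val_inj.
Qed.

(** Additive drift: induction on [n], conditioning on the first draw [i] and applying the hypothesis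
    to [K] and [Phi] with [i] prefixed to their argument. *)
Lemma expected_drift_le (I : finType) n (K : seq I -> I -> R) (Phi : seq I -> R) e :
  (forall w i, 0 <= K w i) -> (forall w, \sum_i K w i = 1) ->
  (forall w, \sum_i K w i * (Phi (rcons w i) - Phi w) <= e) ->
  \sum_(w : n.-tuple I) (\prod_(t < n) K (take t w) (tnth w t)) * Phi w <=
  Phi [::] + n%:R * e.
Proof.
elim: n K Phi => [|n IH] K Phi K0 K1 drift.
  rewrite (bigD1 [tuple])//= big_ord0 mul1r big1 => [|w /negP[]]; first by rewrite mul0r.
  by rewrite (tuple0 w).
rewrite sum_tupleS.
apply: (@le_trans _ _ (\sum_i K [::] i * (Phi [:: i] + n%:R * e))).
  apply: ler_sum => i _.
  have := IH (fun w => K (i :: w)) (fun w => Phi (i :: w))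
    (fun w => K0 (i :: w)) (fun w => K1 (i :: w)) (fun w => drift (i :: w)).
  move=> /(ler_wpM2l (K0 [::] i)); apply: le_trans.
  rewrite mulr_sumr; apply: ler_sum => w _.
  rewrite big_ord_recl /= mulrA; rewrite le_eqVlt; apply/predU1P; left; congr (_ * _ * _).
  apply: eq_bigr => t _; congr (K _ _).
  by rewrite (tnth_nth i) /= -tnth_nth.
under eq_bigr do rewrite mulrDr.
rewrite big_split/= -mulr_suml K1 mul1r -natr1.
have : \sum_i (K [::] i * Phi [:: i] - K [::] i * Phi [::]) <= e.
  by under eq_bigr do rewrite -mulrBr; exact: (drift [::]).
by rewrite sumrB -mulr_suml K1; lra.
Qed.

(** [Y] extends [y] to all rounds because the drift is assumed for words of every length. *)
Lemma expected_path_le (A : forecaster R) T (y : 'I_T -> bool) (Y : nat -> bool)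
    (Phi : seq 'I_(fk A) -> R) e :
  (forall t : 'I_T, Y t = y t) ->
  (forall w, \sum_i fprob (mkseq Y (size w)) w i * (Phi (rcons w i) - Phi w) <= e) ->
  \sum_(q : {ffun 'I_T -> 'I_(fk A)})
     path_prob y q * Phi [seq q t | t <- enum 'I_T] <= Phi [::] + T%:R * e.
Proof.
move=> YE drift.
pose K w i := @fprob R A (mkseq Y (size w)) w i.
have := @expected_drift_le _ T K Phi e (fun w => fprob_ge0 _ w) (fun w => fprob_sum1 _ w) drift.
apply: le_trans; rewrite le_eqVlt; apply/predU1P; left.
rewrite (reindex (fun w : T.-tuple 'I_(fk A) => [ffun t => tnth w t])); last first.
  exists (fun q : {ffun 'I_T -> _} => [tuple q t | t < T]) => [w|q] _.
    by apply: eq_from_tnth => t; rewrite tnth_mktuple ffunE.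
  by apply/ffunP => t; rewrite ffunE tnth_mktuple.
apply: eq_bigr => w _.
have wE : [seq [ffun t => tnth w t] t | t <- enum 'I_T] = w.
  by under eq_map do rewrite ffunE; rewrite map_tnth_enum.
rewrite wE; congr (_ * _); apply: eq_bigr => t _.
rewrite ffunE !map_take wE /K size_take size_tuple ltn_ord; congr (fprob _ _ _).
apply: (@eq_from_nth _ false) => [|k]; first by rewrite size_take size_map size_enum_ord ltn_ord size_mkseq.
rewrite size_take size_map size_enum_ord ltn_ord => kt.
have kT := ltn_trans kt (ltn_ord t).
rewrite nth_take// nth_mkseq// (nth_map t) ?size_enum_ord//.
by rewrite -[in RHS](nth_enum_ord t kT) YE.
Qed.

End Expectation.

(** * Swap regret and calibration error as log-likelihood ratios *)

Section Calibration.
Context {R : realType}.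
Implicit Types (T : nat).

Lemma logloss_fin (p : R) b : 0 < lik p b -> logloss p b = (- ln (lik p b))%:E.
Proof. by rewrite /logloss /neglog; case: b => /= h; rewrite leNgt h. Qed.

(** A swap map giving probability 0 to a realized outcome has infinite loss and contributes [-oo];
    only the other maps need a bound. *)
Lemma SReg_le T (p : 'I_T -> R) (y : 'I_T -> bool) (M : R) :
  (forall t, 0 < p t < 1) ->
  (forall s : R -> R, (forall x, 0 <= x <= 1 -> 0 <= s x <= 1) ->
     (forall t, 0 < lik (s (p t)) (y t)) ->
     \sum_t (ln (lik (s (p t)) (y t)) - ln (lik (p t) (y t))) <= M) ->
  (SReg p y <= M%:E)%E.
Proof.
move=> p01 hM; apply: ge_ereal_sup => _ [s s01 <-].
have [pos|] := boolP [forall t, 0 < lik (s (p t)) (y t)].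
  move/forallP in pos.
  under eq_bigr => t _ do rewrite logloss_fin ?lik_gt0// logloss_fin// -EFinN -EFinD opprK addrC.
  by rewrite sumEFin lee_fin hM.
rewrite negb_forall => /existsP[t]; rewrite -leNgt => st.
rewrite (bigD1 t)//= logloss_fin ?lik_gt0//.
suff -> : logloss (s (p t)) (y t) = +oo%E by rewrite addNye leNye.
by rewrite /logloss /neglog; case: (y t) st => /= ->.
Qed.

Lemma sum_undup (X : eqType) (J : finType) (p : J -> X) (f : J -> R) :
  \sum_(x <- undup [seq p j | j : J]) \sum_(j | p j == x) f j = \sum_j f j.
Proof.
rewrite (exchange_big_dep predT)//=; apply: eq_bigr => j _.
rewrite big_mkcond (bigD1_seq (p j)) ?undup_uniq ?mem_undup ?map_f -?enumT ?mem_enum//=.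
by rewrite eqxx big1 ?addr0// => x; rewrite eq_sym => /negbTE ->.
Qed.

Section Rho.
Context T (p : 'I_T -> R) (y : 'I_T -> bool).

Let ones v : R := \sum_(t < T | p t == v) (y t)%:R.

Let onesC v : nrounds p v - ones v = \sum_(t < T | p t == v) (1 - (y t)%:R).
Proof. by rewrite /nrounds /ones sumrB. Qed.

Let ones_ge0 v : 0 <= ones v.
Proof. by apply: sumr_ge0 => t _; rewrite ler0n. Qed.

Let zeros_ge0 v : 0 <= nrounds p v - ones v.
Proof. by rewrite onesC; apply: sumr_ge0 => t _; case: (y t); rewrite ?subrr ?subr0. Qed.

Let onem_rho v : 0 < nrounds p v -> 1 - rho p y v = (nrounds p v - ones v) / nrounds p v.
Proof. by move=> n0; rewrite mulrBl divff ?gt_eqF. Qed.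

Lemma rho_itv v : 0 <= rho p y v <= 1.
Proof.
have n0 : 0 <= nrounds p v by apply: sumr_ge0.
have := zeros_ge0 v; rewrite subr_ge0 => on.
rewrite divr_ge0 ?ones_ge0//=; have [n00|nn] := eqVneq (nrounds p v) 0.
  by rewrite /rho n00 invr0 mulr0.
by rewrite ler_pdivrMr ?mul1r// lt_def nn.
Qed.

Lemma nrounds_gt0 t : 0 < nrounds p (p t).
Proof. by rewrite /nrounds (bigD1 t)//= ltr_pwDl// sumr_ge0. Qed.

(** Round [t] itself contributes to the empirical frequency of [y t] in its bin. *)
Lemma lik_rho_gt0 t : 0 < lik (rho p y (p t)) (y t).
Proof.
have n0 := nrounds_gt0 t; case yt: (y t) => /=.
  rewrite divr_gt0// (bigD1 t)//= yt ltr_pwDl// sumr_ge0// => *; exact: ler0n.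
rewrite onem_rho// divr_gt0// onesC (bigD1 t)//= yt subr0 ltr_pwDl// sumr_ge0// => k _.
by case: (y k); rewrite ?subrr ?subr0.
Qed.

(** Grouping rounds by predicted value shows that the calibration error is the gain of the
    particular swap map [rho p y]. *)
Lemma KLCalE : (forall t, 0 < p t < 1) ->
  KLCal p y = \sum_t (ln (lik (rho p y (p t)) (y t)) - ln (lik (p t) (y t))).
Proof.
move=> p01; rewrite -(sum_undup p) /KLCal; apply: eq_big_seq => v.
rewrite mem_undup => /mapP[t0 _ ->{v}].
have n0 := nrounds_gt0 t0; have := p01 t0; move: (p t0) n0 => v n0 /andP[v0 v1].
have -> : \sum_(t | p t == v) (ln (lik (rho p y (p t)) (y t)) - ln (lik (p t) (y t))) =
    ones v * (ln (rho p y v) - ln v) +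
    (nrounds p v - ones v) * (ln (1 - rho p y v) - ln (1 - v)).
  rewrite onesC /ones !mulr_suml -big_split/=; apply: eq_bigr => t /eqP ->.
  by case: (y t); rewrite /= ?subrr ?subr0 ?mul0r ?mul1r ?addr0 ?add0r.
rewrite /KLb mulrDr (mulrA _ (rho p y v)) (mulrA _ (1 - rho p y v)); congr (_ + _).
  have -> : nrounds p v * rho p y v = ones v by rewrite mulrC divfK ?gt_eqF.
  (* Without ones in the bin the factor 0 kills both sides, whatever [ln] returns at 0. *)
  have [->|o0] := eqVneq (ones v) 0; first by rewrite !mul0r.
  by rewrite ln_div ?posrE// divr_gt0// lt_def o0 ones_ge0.
have -> : nrounds p v * (1 - rho p y v) = nrounds p v - ones v.
  by rewrite onem_rho// mulrC divfK ?gt_eqF.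
have [->|o0] := eqVneq (nrounds p v - ones v) 0; first by rewrite !mul0r.
by rewrite ln_div ?posrE ?[0 < 1 - v]subr_gt0// onem_rho// divr_gt0// lt_def o0 zeros_ge0.
Qed.

End Rho.

Lemma ln_likelihood (I : finType) (s : I -> R) (h : seq (I * bool)) :
  (forall x, x \in h -> 0 < lik (s x.1) x.2) ->
  ln (likelihood s h) = \sum_(x <- h) ln (lik (s x.1) x.2) /\ 0 < likelihood s h.
Proof.
rewrite /likelihood; elim: h => [|x h IH] pos; first by rewrite !big_nil ln1.
have [z zh|lnh h0] := IH; first by apply: pos; rewrite inE zh orbT.
have x0 : 0 < lik (s x.1) x.2 by apply: pos; rewrite inE eqxx.
by rewrite !big_cons mulr_gt0// lnM ?posrE// lnh.
Qed.

Lemma swap_le_potential (I : finType) T (q : 'I_T -> I) (y : 'I_T -> bool) (s : I -> R) :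
  (forall i, 0 <= s i <= 1) -> (forall t, 0 < lik (s (q t)) (y t)) ->
  \sum_t ln (lik (s (q t)) (y t)) <=
  ln (lapprob [seq (q t, y t) | t <- enum 'I_T]) + #|I|%:R * ln T.+1%:R.
Proof.
move=> s01 pos; set h := [seq _ | _ <- _].
have [|lnh h0] := @ln_likelihood I s h; first by move=> _ /mapP[t _ ->]; exact: pos.
have -> : \sum_t ln (lik (s (q t)) (y t)) = ln (likelihood s h).
  by rewrite lnh big_map big_enum.
have := @likelihood_le R I s h s01; rewrite size_map size_enum_ord => le.
apply: (@le_trans _ _ (ln (T.+1%:R ^+ #|I| * lapprob h))).
  by rewrite ler_ln ?posrE// mulr_gt0 ?lapprob_gt0// exprn_gt0 ?ltr0n.
rewrite lnM ?posrE ?lapprob_gt0 ?exprn_gt0 ?ltr0n// lnXn ?ltr0n//.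
by rewrite addrC mulr_natl.
Qed.

End Calibration.

(** * The forecaster and its rate *)

Section Forecast.
Context {R : realType}.

(** The one-round law depends only on past labelled predictions and covers both values of [b], so
    choosing one per history defines an algorithm. *)
Lemma exists_grid_forecaster N :
  exists f : seq bool -> seq 'I_N.+1 -> 'I_N.+1 -> R,
  [/\ forall ys ps i, 0 <= f ys ps i, forall ys ps, \sum_i f ys ps i = 1 &
    forall ys ps b, \sum_i f ys ps i *
      (ln (lik (laplace (zip ps ys) i) b) - ln (lik (grid N i) b)) <= 36 / N.+1%:R ^+ 2].
Proof.
have M0 : (0 : R) < N.+1%:R ^+ 2 by rewrite exprn_gt0 ?ltr0n.
have le1 : (N.+1%:R ^+ 2)^-1 <= 36 / N.+1%:R ^+ 2 :> R.
  by rewrite ler_peMl ?invr_ge0 ?(ltW M0)//; lra.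
have /choice[f fP] : forall x : seq bool * seq 'I_N.+1, exists P : 'I_N.+1 -> R,
    [/\ forall i, 0 <= P i, \sum_i P i = 1 & forall b, \sum_i P i *
      (ln (lik (laplace (zip x.2 x.1) i) b) - ln (lik (grid N i) b)) <= 36 / N.+1%:R ^+ 2].
  move=> x; apply: exists_prediction_law.
  - exact: grid_itv.
  - exact: laplace_itv.
  - by rewrite divr_ge0// ltW.
  - exact: le_trans (grid_first N) le1.
  - exact: le_trans (grid_last N) le1.
  - exact: grid_step.
by exists (fun ys ps => f (ys, ps)); split=> ys ps; have [] := fP (ys, ps).
Qed.

(** The potential [pot] drifts by at most the one-round bound, and its final value dominates the
    gain of every swap map on the path ([pathle]), hence both the regret and the calibration
    error. *)
Lemma exists_forecaster N : exists A : forecaster R,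
  forall T (y : 'I_T -> bool),
  let bound := N.+1%:R * ln T.+1%:R + T%:R * (36 / N.+1%:R ^+ 2) in
  (exp_SReg A y <= bound%:E)%E /\ exp_KLCal A y <= bound.
Proof.
have [f [f0 f1 fdrift]] := exists_grid_forecaster N.
have gridI (i : 'I_N.+1) := @grid_itv R N i (ltn_ord i).
pose A := Forecaster gridI f0 f1.
exists A => T y bound.
pose Y := nth false [seq y t | t <- enum 'I_T].
have YE (t : 'I_T) : Y t = y t.
  by rewrite /Y (nth_map t) ?size_enum_ord// nth_ord_enum.
pose hist w : seq ('I_N.+1 * bool) := zip w (mkseq Y (size w)).
(* The log-likelihood of Laplace minus that of the forecaster, shifted by the cost [ln (T + 1)] of
   each of the [N + 1] bins. *)
pose pot w : R := N.+1%:R * ln T.+1%:R +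
  (ln (lapprob (hist w)) - \sum_(x <- hist w) ln (lik (grid N x.1) x.2)).
have histE (q : 'I_T -> 'I_N.+1) :
    hist [seq q t | t <- enum 'I_T] = [seq (q t, y t) | t <- enum 'I_T].
  rewrite /hist size_map size_enum_ord -zip_map; congr zip.
  by rewrite -[X in mkseq _ X](size_enum_ord T) -(size_map y) mkseq_nth.
have drift w : \sum_i @fprob R A (mkseq Y (size w)) w i * (pot (rcons w i) - pot w) <=
    36 / N.+1%:R ^+ 2.
  apply: le_trans (fdrift (mkseq Y (size w)) w (Y (size w))).
  apply: ler_sum => i _; apply: ler_wpM2l; first exact: f0.
  rewrite /pot /hist size_rcons mkseqS zip_rcons ?size_mkseq//.
  have L0 := @lik_gt0 R _ (Y (size w)) (laplace_itv (zip w (mkseq Y (size w))) i).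
  rewrite lapprob_rcons lnM ?posrE ?lapprob_gt0// big_rcons/=.
  by rewrite le_eqVlt; apply/predU1P; left; ring.
have total : \sum_(q : {ffun 'I_T -> 'I_(fk A)})
    path_prob y q * pot [seq q t | t <- enum 'I_T] <= bound.
  have := @expected_path_le R A T y Y pot _ YE drift.
  by rewrite /pot/= lapprob_nil ln1 big_nil subrr addr0.
have path0 (q : {ffun 'I_T -> 'I_(fk A)}) : 0 <= path_prob y q.
  by apply: prodr_ge0 => t _; exact: f0.
have pathle (q : {ffun 'I_T -> 'I_(fk A)}) (s : R -> R) :
    (forall x, 0 <= x <= 1 -> 0 <= s x <= 1) ->
    (forall t, 0 < lik (s (fval (q t))) (y t)) ->
    \sum_t (ln (lik (s (fval (q t))) (y t)) - ln (lik (fval (q t)) (y t))) <=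
    pot [seq q t | t <- enum 'I_T].
  move=> s01 pos; rewrite sumrB /pot histE big_map big_enum/= addrA lerB// addrC.
  have := @swap_le_potential R _ T q y (fun i => s (grid N i)) _ pos.
  rewrite card_ord; apply=> i; apply: s01.
  by have /andP[/ltW -> /ltW ->] := gridI i.
have p01 (q : {ffun 'I_T -> 'I_(fk A)}) t : 0 < @fval R A (q t) < 1 by exact: gridI.
split; last first.
  apply: le_trans total; apply: ler_sum => q _; apply: ler_wpM2l => //.
  rewrite KLCalE//; apply: pathle => [x _|t]; [exact: rho_itv|exact: lik_rho_gt0].
rewrite -lee_fin in total; apply: le_trans total.
rewrite -sumEFin; apply: lee_sum => q _.
by rewrite EFinM lee_wpmul2l ?lee_fin//; apply: SReg_le => // s; apply: pathle.
Qed.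

(** With [x = T^(1/3)] one has [x < N + 1 <= 2 * x], so the terms are of order [x * ln T] and
    [T / x^2 = x]; [ln T] is bounded away from 0, which allows passing to its power [5 / 3]. *)
Lemma rate_le T : (2 <= T)%N ->
  forall N, N = Num.truncn (T%:R `^ (3^-1) : R) ->
  N.+1%:R * ln T.+1%:R + T%:R * (36 / N.+1%:R ^+ 2) <=
  152 * (T%:R `^ (3^-1)) * (ln (T%:R) `^ (5 / 3)) :> R.
Proof.
move=> T2 N NE; set x : R := T%:R `^ (3^-1).
have T1 : (1 : R) <= T%:R by rewrite ler1n; lia.
have T0 : (0 : R) < T%:R by lra.
have x0 : 0 < x by rewrite powR_gt0.
have x1 : 1 <= x.
  by rewrite -(powRr0 (T%:R : R)) /x ler_powR// invr_ge0.
have xT : x ^+ 3 = T%:R.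
  by rewrite -powR_mulrn ?(ltW x0)// /x -powRrM mulVf ?powRr1 ?(ltW T0)// pnatr_eq0.
have /andP[Nx xN] := truncn_itv (ltW x0); rewrite -NE in Nx xN.
set l : R := ln T%:R.
(* [ln 2 >= 1 / 2] comes from [ln (1 / 2) <= 1 / 2 - 1]. *)
have l12 : 1 / 2 <= l.
  apply: (@le_trans _ _ (ln 2)); last by rewrite ler_ln ?posrE// ler_nat.
  have := @ln_le_sub1 R 2^-1; rewrite lnV ?posrE//; lra.
have lS : ln T.+1%:R <= 2 * l.
  have -> : 2 * l = ln (T%:R ^+ 2 : R) by rewrite lnXn// mulr_natl.
  rewrite ler_ln ?posrE ?ltr0n ?exprn_gt0// -natrX ler_nat; nia.
set z := l `^ (5 / 3).
have lz : l <= 2 * z.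
  have -> : z = l * l `^ (2 / 3).
    have l0 : 0 < l by lra.
    rewrite /z -[X in _ = X * _]powRr1 ?(ltW l0)// -powRD; first by congr (_ `^ _); field.
    by rewrite (gt_eqF l0) implybT.
  have : 1 / 2 <= l `^ (2 / 3).
    apply: (@le_trans _ _ ((1 / 2) `^ (2 / 3))); last by apply: ge0_ler_powR; rewrite ?nnegrE; lra.
    rewrite -{1}[1 / 2 : R]powRr1; last lra.
    by apply: ger_powR; lra.
  move=> h; have := @ler_wpM2l R l _ _ _ h; lra.
have hN : T%:R * (36 / N.+1%:R ^+ 2) <= 36 * x.
  have M0 : (0 : R) < N.+1%:R by rewrite ltr0n.
  rewrite mulrA ler_pdivrMr ?exprn_gt0// -xT.
  have : x ^+ 2 <= N.+1%:R ^+ 2 by rewrite ler_pXn2r ?nnegrE ?ltW.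
  nra.
have hl : N.+1%:R * ln T.+1%:R <= 2 * x * (2 * l).
  apply: ler_pM; rewrite ?ler0n ?ln_ge0 ?ler1n//.
  by rewrite -natr1; lra.
have xl := ler_wpM2l (ltW x0) lz.
have xz : x * 1 <= x * (4 * z) by apply: ler_wpM2l; lra.
(* Here [4 * x * l <= 8 * x * z] and [36 * x <= 144 * x * z], whence [152 = 8 + 144]. *)
by apply: le_trans (lerD hl hN) _; lra.
Qed.

End Forecast.

Theorem theorem1 (R : realType) :
  exists C : R, forall T : nat, (2 <= T)%N ->
    exists A : forecaster R, forall y : 'I_T -> bool,
      let bound := C * (T%:R `^ (3^-1)) * (ln (T%:R) `^ (5 / 3)) in
      (exp_SReg A y <= bound%:E)%E /\ exp_KLCal A y <= bound.
Proof.
exists 152 => T T2; pose N := Num.truncn (T%:R `^ (3^-1) : R).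
have le := @rate_le R T T2 N erefl.
have [A /(_ T) hA] := @exists_forecaster R N.
exists A => y bound; have [hS hK] := hA y.
split; last exact: le_trans le.
by apply: le_trans hS _; rewrite lee_fin.
Qed.
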